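(* Let $G$ be a finite connected simple graph with edge set $E$, cycle space $Z(G)$ and cut space $B(G)$. There is exactly one $\mathrm{Cyc}(G)$-invariant projection $P:\ell_2(E)\to Z(G)$ (that is, linear projection of $\mathbb{R}^E$ onto $Z(G)$ commuting with every element of $\mathrm{Cyc}(G)$) if and only if the natural representations of $\mathrm{Cyc}(G)$ on $Z(G)$ and on $B(G)$ do not have equivalent restrictions to non-zero subspaces; that is, if and only if there do not exist non-zero $\mathrm{Cyc}(G)$-invariant subspaces $U\subseteq Z(G)$ and $V\subseteq B(G)$ such that the real representations of $\mathrm{Cyc}(G)$ on $U$ and on $V$ are equivalent.
   Context: Fix an arbitrary orientation of the edges of $G=(V,E)$; for an edge $e$ let $e^-$ be its tail and $e^+$ its head. The cycle space is $Z(G)=\{F\in\mathbb{R}^E:\ \sum_{e^+=v}F(e)=\sum_{e^-=v}F(e)\text{ for all }v\in V\}$, and the cut space $B(G)$ is its orthogonal complement in $\mathbb{R}^E$ with respect to the standard inner product. $\ell_1(E)$ and $\ell_2(E)$ denote $\mathbb{R}^E$ with the $\ell_1$- and $\ell_2$-norms. $\mathrm{Cyc}(G)$ is the group of linear isometries of $\ell_1(E)$ that map $Z(G)$ onto itself. Since linear isometries of $\ell_1(E)$ are signed permutations of the unit vector basis, they are orthogonal on $\ell_2(E)$, so $B(G)$ is also invariant under $\mathrm{Cyc}(G)$; the natural representations are the restrictions of the action of $\mathrm{Cyc}(G)$ to $Z(G)$ and $B(G)$. A projection $P$ onto $Z(G)$ is $\mathrm{Cyc}(G)$-invariant if $PA=AP$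 for every $A\in\mathrm{Cyc}(G)$. *)

(* Defs.v *)
From HB Require Import structures.
From mathcomp Require Import all_boot all_order all_algebra.
From mathcomp Require Import reals.

Set Implicit Arguments.
Unset Strict Implicit.
Unset Printing Implicit Defensive.

Import Order.TTheory GRing.Theory Num.Theory.

Local Open Scope ring_scope.

Record sgraph (T : finType) := SGraph {
  adj : rel T;
  adj_sym : symmetric adj;
  adj_irr : irreflexive adj
}.

Definition connected_graph (T : finType) (G : sgraph T) : Prop :=
  (0 < #|T|)%N /\ (forall x y : T, connect (adj G) x y).

Definition is_edge (T : finType) (G : sgraph T) : pred {set T} :=
  fun A => [exists x, exists y, adj G x y && (A == [set x; y])].

Definition edge (T : finType) (G : sgraph T) := {A : {set T} | is_edge G A}.
HB.instance Definition _ (T : finType) (G : sgraph T) := SubFinite.on (edge G).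

Record orientation (T : finType) (G : sgraph T) := Orientation {
  tail : edge G -> T;
  head : edge G -> T;
  tail_head : forall e : edge G, val e = [set tail e; head e]
}.

(* The regular module R^o (convertible to R) is what gives R^E its canonical  *)
(* vectType structure.                                                        *)
Notation edge_space R G := {ffun edge G -> R^o}.
Notation vertex_space R T := {ffun T -> R^o}.

Section InnerProduct.
Variables (R : realType) (T : finType) (G : sgraph T).
Implicit Types (u v F : edge_space R G).

Definition edot u v : R := \sum_e u e * v e.

Lemma edotC u v : edot u v = edot v u.
Proof. by apply: eq_bigr => e _; rewrite mulrC. Qed.

Lemma edot_linear u : linear (edot u : edge_space R G -> R^o).
Proof.
move=> a v w; rewrite /edot scaler_sumr -big_split /=; apply: eq_bigr => e _.
by rewrite !ffunE mulrDr mulrCA.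
Qed.

Lemma edot_linearl u : linear (edot^~ u : edge_space R G -> R^o).
Proof. by move=> a v w; rewrite -!(edotC u) edot_linear. Qed.

HB.instance Definition _ :=
  bilinear_isBilinear.Build R (edge_space R G) (edge_space R G) R^o *%R *%R edot
    (edot_linearl, edot_linear).

Lemma edot_herm u v : edot u v = (-1) ^+ false * idfun (edot v u).
Proof. by rewrite expr0 mul1r edotC. Qed.

HB.instance Definition _ :=
  isHermitianSesquilinear.Build R (edge_space R G) false idfun edot edot_herm.

Definition l1norm F : R := \sum_e `|F e : R|.

End InnerProduct.

Section CycleSpace.
Variables (R : realType) (T : finType) (G : sgraph T) (o : orientation G).
Implicit Types (F : edge_space R G) (v : T).

Definition boundary F : vertex_space R T :=
  [ffun v => \sum_(e | head o e == v) F e - \sum_(e | tail o e == v) F e].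

Lemma boundary_linear : linear boundary.
Proof.
move=> a u w; apply/ffunP=> v; rewrite !ffunE.
under eq_bigr do rewrite !ffunE.
under [X in _ - X]eq_bigr do rewrite !ffunE.
by rewrite !big_split /= -!scaler_sumr scalerBr opprD addrACA.
Qed.

HB.instance Definition _ :=
  GRing.isLinear.Build R (edge_space R G) (vertex_space R T) *:%R boundary
    boundary_linear.

Definition cycle_space : {vspace edge_space R G} := lker (linfun boundary).

Definition cut_space : {vspace edge_space R G} :=
  orthov (@edot R T G : {symmetric edge_space R G}) cycle_space.

Lemma mem_cycle_space F :
  reflect (forall v, \sum_(e | head o e == v) F e = \sum_(e | tail o e == v) F e)
          (F \in cycle_space).
Proof.
rewrite memv_ker lfunE /=; apply: (iffP eqP) => [F0 v|FE].
  by move/ffunP/(_ v): F0; rewrite !ffunE => /eqP; rewrite subr_eq0 => /eqP.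
by apply/ffunP=> v; rewrite !ffunE FE subrr.
Qed.

Lemma mem_cut_space F :
  reflect {in cycle_space, forall H, edot F H = 0} (F \in cut_space).
Proof.
exact: (@mem_orthovP _ _ _ _ (@edot R T G : {symmetric edge_space R G})).
Qed.

End CycleSpace.

Section CycleIsometries.
Variables (R : realType) (T : finType) (G : sgraph T) (o : orientation G).
Local Notation W := (edge_space R G).
Implicit Types (A : 'End(W)).

Definition Cyc A : Prop :=
  (forall F : W, l1norm (A F) = l1norm F) /\
  (A @: cycle_space R o)%VS = cycle_space R o.

Lemma l1norm_eq0 (F : W) : (l1norm F == 0) = (F == 0).
Proof.
apply/eqP/eqP => [/eqP|->]; last by rewrite /l1norm big1 // => e _; rewrite ffunE normr0.
rewrite psumr_eq0 // => /allP F0; apply/ffunP => e; rewrite ffunE.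
by apply/eqP; rewrite -normr_eq0; apply: F0; rewrite mem_index_enum.
Qed.

Lemma Cyc_lker0 A : Cyc A -> lker A == 0%VS.
Proof.
move=> [iA _]; apply/eqP/vspaceP => F; rewrite memv_ker memv0.
by rewrite -!l1norm_eq0 iA.
Qed.

Lemma Cyc1 : Cyc \1%VF.
Proof. by split=> [F|]; rewrite ?lim1g // id_lfunE. Qed.

Lemma CycM A B : Cyc A -> Cyc B -> Cyc (A \o B)%VF.
Proof.
move=> [iA ZA] [iB ZB]; split=> [F|]; first by rewrite comp_lfunE iA iB.
by rewrite limg_comp ZB ZA.
Qed.

Lemma CycV A : Cyc A -> Cyc (A^-1)%VF.
Proof.
move=> CA; have A0 := Cyc_lker0 CA; case: CA => [iA ZA]; split=> [F|].
  by rewrite -{2}[F](lker0_lfunVK A0) iA.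
by rewrite -{1}ZA -limg_comp lker0_compVf // lim1g.
Qed.

End CycleIsometries.

Section Representations.
Variables (K : fieldType) (W : vectType K).
(* A group of automorphisms of W is given by its membership predicate. *)
Variable (grp : 'End(W) -> Prop).
Implicit Types (A P : 'End(W)) (U V : {vspace W}).

Definition invariant_subspace U : Prop :=
  forall A, grp A -> (A @: U <= U)%VS.

(* The restriction of A to U; only meaningful when A maps U into itself. *)
Definition restr U A : 'End(subvs_of U) :=
  linfun (vsproj U \o A \o vsval).

Lemma restrE U A (u : subvs_of U) :
  (A @: U <= U)%VS -> vsval (restr U A u) = A (vsval u).
Proof.
move=> UA; rewrite lfunE /= vsprojK //.
by apply: (subvP UA); apply: memv_img; apply: subvsP.
Qed.

Definition equivalent_restrictions U V : Prop :=
  exists phi : 'Hom(subvs_of U, subvs_of V),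
    bijective phi /\
    (forall A, grp A -> (phi \o restr U A)%VF = (restr V A \o phi)%VF).

Definition projection_onto U P : Prop := (P \o P)%VF = P /\ limg P = U.

Definition commutes_with_group P : Prop :=
  forall A, grp A -> (P \o A)%VF = (A \o P)%VF.

End Representations.

(* Main.v *)
Require Import Defs.
From HB Require Import structures.
From mathcomp Require Import all_boot all_order all_algebra.
From mathcomp Require Import reals.
From mathcomp Require Import lra.

Set Implicit Arguments.
Unset Strict Implicit.
Unset Printing Implicit Defensive.

Import Order.TTheory GRing.Theory Num.Theory.

Local Open Scope ring_scope.

(* A linear isometry of l1(E) maps unit vectors to unit vectors up to sign, so
   Cyc(G) acts by orthogonal maps and the orthogonal projection P0 onto Z(G) is
   invariant. If P is another invariant projection, P - P0 vanishes on Z(G) and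
   has values in Z(G), so it induces an equivalence between the orthogonal
   complement of its kernel, inside B(G), and its image. Conversely, an
   equivalence U -> V with U in Z(G) and V in B(G) yields a second invariant
   projection: P0 plus its inverse composed with the orthogonal projection
   onto V. *)

(** * Orthogonal complements and projections for an anisotropic symmetric form *)

Section AnisotropicForm.
Variables (K : fieldType) (W : vectType K) (form : {symmetric W}).
Hypothesis form_aniso : forall u, form u u = 0 -> u = 0.
Implicit Types (u v : W) (A P D : 'End(W)) (U V Z : {vspace W}).

Local Notation "V ^_|_" := (orthov form V) (format "V ^_|_") : vspace_scope.

Lemma capv_orthov V : (V :&: V^_|_ = 0)%VS.
Proof.
apply/eqP; rewrite -subv0; apply/subvP => u /memv_capP[uV /mem_orthovP uV'].
by rewrite memv0; apply/eqP/form_aniso/uV'.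
Qed.

(** Rank-nullity for the map sending [u] to its products with a basis of [V]: the kernel lies in the
    complement, and the target has dimension [\dim V]. *)
Lemma leq_dim_orthov V : (\dim {:W} <= \dim V + \dim (V^_|_))%N.
Proof.
pose g u : 'rV[K]_(\dim V) := \row_i form u (vbasis V)`_i.
have g_lin : linear g.
  by move=> a u v; apply/rowP => i; rewrite !mxE linearPl.
pose gL : {linear W -> 'rV[K]_(\dim V)} :=
  HB.pack g (GRing.isLinear.Build K W 'rV[K]_(\dim V) *:%R g g_lin).
have kerg : (lker (linfun gL) <= V^_|_)%VS.
  apply/subvP => u; rewrite memv_ker lfunE /= => /eqP/rowP gu0.
  apply/mem_orthovP => v /coord_vbasis->.
  rewrite linear_sumr big1 // => i _.
  by rewrite linearZr /=; move: (gu0 i); rewrite !mxE => ->; rewrite mulr0.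
rewrite -(limg_ker_dim (linfun gL) fullv) capfv addnC leq_add ?dimvS //.
by apply: leq_trans (dimvS (subvf _)) _; rewrite dimvf /dim /= mul1n.
Qed.

Lemma addv_orthov V : (V + V^_|_)%VS = fullv.
Proof.
apply/eqP; rewrite -(geq_leqif (dimv_leqif_eq (subvf _))).
by rewrite dimv_disjoint_sum ?capv_orthov ?leq_dim_orthov.
Qed.

(** One inclusion is symmetry of the form. Equality follows by dimension, since both [V] and its
    double complement are direct complements of [V^_|_]. *)
Lemma orthovK V : (V^_|_^_|_)%VS = V.
Proof.
apply/eqP; rewrite eq_sym -(geq_leqif (dimv_leqif_eq _)); last first.
  by rewrite orthov_sym subvv.
have:= dimv_disjoint_sum (capv_orthov V); rewrite addv_orthov.
have:= dimv_disjoint_sum (capv_orthov (V^_|_)%VS); rewrite addv_orthov => ->.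
by rewrite addnC => /eqP; rewrite eqn_add2r => /eqP->.
Qed.

Lemma orthovS U V : (U <= V)%VS -> (V^_|_ <= U^_|_)%VS.
Proof.
move=> UV; apply/subvP => w /mem_orthovP wV.
by apply/mem_orthovP => u uU; apply/wV/(subvP UV).
Qed.

Definition orthoproj V : 'End(W) := daddv_pi V (V^_|_)%VS.

Lemma orthoproj_mem V u : orthoproj V u \in V.
Proof. exact: memv_pi. Qed.

Lemma orthoproj_id V : {in V, forall u, orthoproj V u = u}.
Proof. by move=> u uV; rewrite /orthoproj daddv_pi_id ?capv_orthov. Qed.

Lemma orthoproj_eq0 V : {in (V^_|_)%VS, forall u, orthoproj V u = 0}.
Proof.
move=> u uV; have:= daddv_pi_add (capv_orthov V) (_ : u \in V + V^_|_)%VS.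
rewrite addv_orthov memvf => /(_ isT).
rewrite [daddv_pi _ V u]daddv_pi_id // 1?capvC ?capv_orthov //.
by move/(canRL (addrK _)); rewrite subrr.
Qed.

Lemma orthovD_ind (Q : W -> Prop) V :
  {in V & (V^_|_)%VS, forall u v, Q (u + v)} -> forall w, Q w.
Proof.
move=> QD w; have: w \in (V + V^_|_)%VS by rewrite addv_orthov memvf.
by case/memv_addP => u uV [v vV ->]; apply: QD.
Qed.

(** * Isometries and their invariant subspaces *)

Section Isometry.
Variable A : 'End(W).
Hypothesis isoA : forall u v, form (A u) (A v) = form u v.

Lemma isometry_lker0 : lker A == 0%VS.
Proof.
apply/eqP/vspaceP => u; rewrite memv_ker memv0.
apply/eqP/eqP => [Au0|->]; last by rewrite linear0.
by apply: form_aniso; rewrite -isoA Au0 linear0r.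
Qed.

Lemma isometry_limg V : (A @: V <= V)%VS -> (A @: V)%VS = V.
Proof.
move=> AV; apply/eqP; rewrite -(geq_leqif (dimv_leqif_eq AV)).
by rewrite limg_dim_eq // (eqP isometry_lker0) capv0.
Qed.

(** By injectivity and dimension [A] maps [V] onto itself, so each vector of [V] is some [A w] with
    [w] in [V], and [form (A u) (A w) = form u w]. *)
Lemma isometry_orthov V : (A @: V <= V)%VS -> (A @: V^_|_ <= V^_|_)%VS.
Proof.
move=> AV; apply/subvP => _ /memv_imgP[u /mem_orthovP uV ->].
apply/mem_orthovP => v; rewrite -(isometry_limg AV) => /memv_imgP[w wV ->].
by rewrite isoA uV.
Qed.

Lemma orthoproj_commute V : (A @: V <= V)%VS ->
  (orthoproj V \o A)%VF = (A \o orthoproj V)%VF.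
Proof.
move=> AV; apply/lfunP; apply: (orthovD_ind (V := V)) => u v uV vV.
have Au : A u \in V by apply/(subvP AV)/memv_img.
have Av : A v \in (V^_|_)%VS by apply/(subvP (isometry_orthov AV))/memv_img.
rewrite !lfunE /= !linearD /=.
by rewrite (orthoproj_id Au) (orthoproj_id uV) !orthoproj_eq0 ?linear0.
Qed.

End Isometry.

(** * Invariant projections versus equivalent subrepresentations *)

Variables (grp : 'End(W) -> Prop) (Z : {vspace W}).
Hypothesis grp_iso : forall A, grp A -> forall u v, form (A u) (A v) = form u v.
Hypothesis grpZ : invariant_subspace grp Z.

Lemma orthoproj_projection V : projection_onto V (orthoproj V).
Proof.
split.
  by apply/lfunP => u; rewrite lfunE /= orthoproj_id ?orthoproj_mem.
apply/vspaceP => u; apply/memv_imgP/idP => [[v _ ->]|uV].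
  exact: orthoproj_mem.
by exists u; rewrite ?memvf ?orthoproj_id.
Qed.

Lemma projection_onto_mem V P u : projection_onto V P -> P u \in V.
Proof. by case=> _ <-; rewrite memv_img ?memvf. Qed.

Lemma projection_onto_id V P : projection_onto V P -> {in V, forall u, P u = u}.
Proof.
case=> PP imP u; rewrite -imP => /memv_imgP[v _ ->].
by rewrite -comp_lfunE PP.
Qed.

Lemma unique_projection_no_equivalence :
    (exists! P, projection_onto Z P /\ commutes_with_group grp P) ->
  ~ exists U V, [/\ U <> 0%VS /\ V <> 0%VS,
           (U <= Z)%VS /\ (V <= Z^_|_)%VS,
           invariant_subspace grp U, invariant_subspace grp V
         & equivalent_restrictions grp U V].
Proof.
case=> P0 [[prP0 cP0] uniqP0] [U [V [[_ V0] [UZ VZ] gU gV [phi [bphi cphi]]]]].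
have kphi : lker phi == 0%VS by apply/lker0P/bij_inj.
have phiK : cancel phi phi^-1%VF by apply: lker0_lfunK.
have phiVK : cancel phi^-1%VF phi.
  by case: bphi => psi _ psiK v; rewrite -[v]psiK phiK.
(* [D] kills [Z], because [V] is orthogonal to [Z], and takes values in [U], inside [Z]; hence
   [P0 + D] is again a projection onto [Z]. *)
pose D : 'End(W) :=
  (linfun vsval \o phi^-1 \o linfun (vsproj V) \o orthoproj V)%VF.
have DE u : D u = vsval (phi^-1%VF (vsproj V (orthoproj V u))).
  by do 5! rewrite ?lfunE /=.
have DU u : D u \in U by rewrite DE subvsP.
have DZ u : D u \in Z by apply: (subvP UZ).
have DZ0 : {in Z, forall u, D u = 0}.
  move=> u uZ; rewrite DE orthoproj_eq0 ?linear0 //.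
  by apply: (subvP (orthovS VZ)); rewrite orthovK.
have cD A : grp A -> (D \o A)%VF = (A \o D)%VF.
  move=> gA; apply/lfunP => u; rewrite !lfunE /= !DE.
  have /lfunP/(_ u) := orthoproj_commute (grp_iso gA) (gV _ gA).
  rewrite !lfunE /= => ->.
  rewrite -(restrE _ (gU _ gA)); congr vsval.
  (* Equivariance of the inverse of [phi] is reduced to that of [phi] by applying [phi] to both
     sides. *)
  apply: (can_inj phiK); rewrite phiVK.
  have /lfunP/(_ (phi^-1%VF (vsproj V (orthoproj V u)))) := cphi _ gA.
  rewrite !comp_lfunE phiVK => ->; apply: subvs_inj => /=.
  rewrite restrE ?gV // !vsprojK ?orthoproj_mem //.
  by apply/(subvP (gV _ gA))/memv_img/orthoproj_mem.
have [w wV w0] : exists2 w, w \in V & w != 0.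
  by exists (vpick V); rewrite ?memv_pick // vpick0; apply/eqP.
have D_neq0 : D w != 0.
  rewrite DE orthoproj_id //; apply: contra_neq w0 => Dw0.
  rewrite -(vsprojK wV) -[vsproj V w]phiVK.
  by rewrite (_ : phi^-1%VF _ = 0) ?linear0 //; apply: subvs_inj.
suff /uniqP0 : projection_onto Z (P0 + D) /\ commutes_with_group grp (P0 + D).
  by move/(canLR (addKr _)); rewrite addNr => D0; rewrite -D0 lfunE eqxx in D_neq0.
split; last first.
  by move=> A gA; rewrite comp_lfunDl comp_lfunDr cP0 ?cD.
have P0id := projection_onto_id prP0.
have PZ u : (P0 + D) u \in Z.
  by rewrite lfunE /= memvD // (projection_onto_mem _ prP0).
have Pid : {in Z, forall u, (P0 + D) u = u}.
  by move=> u uZ; rewrite lfunE /= P0id // DZ0 // addr0.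
split; first by apply/lfunP => u; rewrite lfunE /= Pid.
apply/vspaceP => u; apply/memv_imgP/idP => [[v _ ->]|uZ]; first exact: PZ.
by exists u; rewrite ?memvf ?Pid.
Qed.

Lemma no_equivalence_unique_projection :
  ~ (exists U V, [/\ U <> 0%VS /\ V <> 0%VS,
           (U <= Z)%VS /\ (V <= Z^_|_)%VS,
           invariant_subspace grp U, invariant_subspace grp V
         & equivalent_restrictions grp U V]) ->
  exists! P, projection_onto Z P /\ commutes_with_group grp P.
Proof.
move=> noUV; exists (orthoproj Z); split.
  split; first exact: orthoproj_projection.
  by move=> A gA; refine (orthoproj_commute (grp_iso gA) (grpZ gA)).
move=> P [prP cP]; apply/eqP/negP => /negP PN; apply: noUV.
(* On this [V] the map [D] is injective with the same image as on the whole space; both kernel and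
   image are invariant since [D] commutes with the group. *)
pose D : 'End(W) := P - orthoproj Z; pose V := ((lker D)^_|_)%VS.
have DE u : D u = P u - orthoproj Z u by rewrite /D !lfunE /= lfunE.
have D0 : D != 0 by rewrite subr_eq0 eq_sym.
have cD A : grp A -> forall u, D (A u) = A (D u).
  move=> gA u; rewrite !DE linearB /=.
  have /lfunP/(_ u) := cP _ gA; rewrite !lfunE /= => ->.
  have /lfunP/(_ u) := orthoproj_commute (grp_iso gA) (grpZ gA).
  by rewrite !lfunE /= => ->.
have kerDV : (lker D :&: V = 0)%VS by apply: capv_orthov.
have gker A : grp A -> (A @: lker D <= lker D)%VS.
  move=> gA; apply/subvP => _ /memv_imgP[u + ->].
  by rewrite !memv_ker cD // => /eqP->; rewrite linear0.
have gV : invariant_subspace grp V.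
  by move=> A gA; refine (isometry_orthov (grp_iso gA) (gker _ gA)).
have gU : invariant_subspace grp (limg D).
  move=> A gA; apply/subvP => _ /memv_imgP[_ /memv_imgP[u _ ->] ->].
  by rewrite -cD // memv_img ?memvf.
have DV : (D @: V)%VS = limg D.
  have /eqP D_ker0 : (D @: lker D == 0)%VS by rewrite -lkerE.
  by rewrite -[RHS]/(D @: fullv)%VS -(addv_orthov (lker D)) limgD D_ker0 add0v.
pose d : 'Hom(subvs_of V, subvs_of (limg D)) := linfun (vsproj (limg D) \o D \o vsval).
have dE x : vsval (d x) = D (vsval x).
  by rewrite lfunE /= vsprojK // memv_img ?memvf.
have d_inj : lker d == 0%VS.
  rewrite -subv0; apply/subvP => x; rewrite memv_ker memv0 => /eqP dx0.
  have: vsval x \in (lker D :&: V)%VS.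
    by rewrite memv_cap subvsP memv_ker -dE dx0 linear0 eqxx.
  by rewrite kerDV memv0 => /eqP x0; apply/eqP/subvs_inj.
have dVK : cancel d^-1%VF d.
  move=> y; rewrite limg_lfunVK //.
  have : vsval y \in (D @: V)%VS by rewrite DV subvsP.
  case/memv_imgP => v vV yE.
  by apply/memv_imgP; exists (vsproj V v); rewrite ?memvf //; apply: subvs_inj;
    rewrite dE vsprojK // -yE.
exists (limg D), V; split=> //.
- have limgD0 : limg D <> 0%VS.
    move=> imD0; case/negP: D0; apply/eqP/lfunP => u; rewrite [RHS]lfunE /=.
    by apply/eqP; rewrite -memv0 -imD0 memv_img ?memvf.
  by split=> // V0; apply: limgD0; rewrite -DV V0 limg0.
- split.
    apply/subvP => _ /memv_imgP[u _ ->].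
    by rewrite DE memvB ?(projection_onto_mem _ prP) ?orthoproj_mem.
  (* Both projections fix [Z] pointwise, so [Z] lies in [lker D]; taking complements reverses the
     inclusion. *)
  apply: orthovS; apply/subvP => u uZ.
  by rewrite memv_ker DE (projection_onto_id prP) // orthoproj_id // subrr.
(* The equivalence must go from the subspace of [Z] to that of its complement, whereas [d] goes the
   other way. *)
exists d^-1%VF; split.
  by exists d; [exact: dVK | exact: lker0_lfunK].
move=> A gA; apply/lfunP => y; rewrite !lfunE /=.
apply: (can_inj (lker0_lfunK d_inj)); rewrite dVK; apply: subvs_inj => /=.
by rewrite restrE ?gU // dE restrE ?gV // cD // -dE dVK.
Qed.

End AnisotropicForm.

(** * Linear isometries of the l1-norm are signed permutations *)

Section L1Isometry.
Variables (R : realType) (T : finType) (G : sgraph T).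
Local Notation W := (edge_space R G).
Implicit Types (u v : W) (e f g : edge G).

Lemma normrDB_le (a b : R) : `|a + b| + `|a - b| <= 2 * (`|a| + `|b|).
Proof. by have := ler_normD a b; have := ler_normB a b; lra. Qed.

(** The left side is twice the larger of [|a|] and [|b|], so equality forces the smaller one to
    vanish; the proof checks this by signs. *)
Lemma normrDB_eqP (a b : R) :
  reflect (a * b = 0) (`|a + b| + `|a - b| == 2 * (`|a| + `|b|)).
Proof.
apply: (iffP eqP) => [ab|/eqP]; last first.
  by rewrite mulf_eq0 => /orP[]/eqP->;
    rewrite ?add0r ?sub0r ?addr0 ?subr0 ?normrN normr0; lra.
apply/eqP; rewrite mulf_eq0; apply/norP => -[a0 b0]; move: ab.
case: (ltrgt0P a) a0 => // a0 _; case: (ltrgt0P b) b0 => // b0 _;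
  by case: (ger0P (a + b)); case: (ger0P (a - b)); lra.
Qed.

(** Disjointness of supports is expressed through the norm alone, so linear isometries preserve it.
    Every edge contributes a nonnegative deficit, hence the total vanishes only if each deficit
    does. *)
Lemma l1norm_disjointP u v :
  reflect (forall g, u g * v g = 0)
    (l1norm (u + v) + l1norm (u - v) == 2 * (l1norm u + l1norm v)).
Proof.
rewrite /l1norm -!big_split /= mulr_sumr eq_sym -subr_eq0 -sumrB /=.
rewrite psumr_eq0 => [|g _]; last by rewrite subr_ge0 !ffunE normrDB_le.
apply: (iffP allP) => [uv g|uv g _].
  have := uv g (mem_index_enum g).
  by rewrite !ffunE subr_eq0 eq_sym => /normrDB_eqP.
by rewrite !ffunE subr_eq0 eq_sym; apply/normrDB_eqP.
Qed.

Definition unit_edge e : W := [ffun f => (f == e)%:R].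

Lemma edge_space_sum u : u = \sum_e u e *: unit_edge e.
Proof.
apply/ffunP => g; rewrite sum_ffunE (bigD1 g) //= !ffunE eqxx [_ *: _]mulr1.
rewrite big1 ?addr0 // => e /negPf eg.
by rewrite !ffunE eq_sym eg scaler0.
Qed.

Lemma l1norm_unit_edge e : l1norm (unit_edge e) = 1.
Proof.
rewrite /l1norm (bigD1 e) //= ffunE eqxx normr1 big1 ?addr0 // => f /negPf fe.
by rewrite ffunE fe normr0.
Qed.

Variable A : 'End(W).
Hypothesis isoA : forall u, l1norm (A u) = l1norm u.

Lemma l1_isometry_disjoint u v :
  (forall g, u g * v g = 0) -> forall g, A u g * A v g = 0.
Proof.
move/l1norm_disjointP => uv; apply/l1norm_disjointP.
by rewrite -linearD -linearB !isoA.
Qed.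

(* The images of the unit vectors are nonzero with disjoint supports, and there
   are as many of them as coordinates, so each support is a single edge. *)
Lemma l1_isometry_signed_perm :
  exists (p : edge G -> edge G) (c : edge G -> R),
    [/\ injective p, forall e, `|c e| = 1 & forall u e, A u (p e) = c e * u e].
Proof.
have supp e : exists g, A (unit_edge e) g != 0.
  apply/existsP; rewrite -negb_forall; apply/negP => /forallP A0.
  have /eqP := l1norm_unit_edge e; rewrite -isoA /l1norm big1 ?(eq_sym 0) ?oner_eq0 //.
  by move=> g _; rewrite (eqP (A0 g)) normr0.
pose p e := xchoose (supp e).
have pP e : A (unit_edge e) (p e) != 0 by exact: (xchooseP (supp e)).
have disj e f g : e != f -> A (unit_edge e) g * A (unit_edge f) g = 0.
  move=> ef; apply: l1_isometry_disjoint => h; rewrite !ffunE -natrM mulnb.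
  by case: eqP => //= ->; rewrite (negPf ef).
have p_inj : injective p.
  move=> e f pef; apply/eqP/negPn/negP => ef.
  have /eqP := disj e f (p e) ef.
  by rewrite mulf_eq0 (negPf (pP e)) pef (negPf (pP f)).
have A0 e f : f != e -> A (unit_edge f) (p e) = 0.
  move=> fe; apply/eqP; have /eqP := disj f e (p e) fe.
  by rewrite mulf_eq0 (negPf (pP e)) orbF.
exists p, (fun e => A (unit_edge e) (p e)); split=> // [e|u e].
  (* An injective [p] on the finite edge set is a bijection, so the norm may be summed along [p]; by
     [A0] only the term at [p e] survives. *)
  rewrite -(l1norm_unit_edge e) -isoA /l1norm (reindex_inj p_inj) /=.
  rewrite (bigD1 e) //= big1 ?addr0 // => f fe.
  by rewrite A0 ?normr0 // eq_sym.
rewrite [in LHS](edge_space_sum u) linear_sum sum_ffunE (bigD1 e) //=.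
rewrite big1 ?addr0 => [|f fe]; last by rewrite linearZ ffunE A0 ?scaler0.
by rewrite linearZ ffunE [LHS]mulrC.
Qed.

Lemma l1_isometry_edot u v : edot (A u) (A v) = edot u v.
Proof.
have [p [c [p_inj c1 Ap]]] := l1_isometry_signed_perm.
rewrite /edot (reindex_inj p_inj); apply: eq_bigr => e _ /=.
by rewrite !Ap mulrACA -expr2 -real_normK ?num_real // c1 expr1n mul1r.
Qed.

End L1Isometry.

(** * Application to the cycle and cut spaces *)

Lemma edot_aniso (R : realType) (T : finType) (G : sgraph T)
  (u : edge_space R G) : edot u u = 0 -> u = 0.
Proof.
move/eqP; rewrite psumr_eq0 => [/allP u0|e _]; last by rewrite -expr2 sqr_ge0.
apply/ffunP => e; rewrite ffunE; apply/eqP.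
by have := u0 e (mem_index_enum e); rewrite -expr2 sqrf_eq0.
Qed.

Theorem theorem5 (R : realType) (T : finType) (G : sgraph T)
    (o : orientation G) (Gconn : connected_graph G) :
  (exists! P : 'End(edge_space R G),
     projection_onto (cycle_space R o) P /\
     commutes_with_group (Cyc (R := R) o) P)
  <->
  ~ (exists U V : {vspace edge_space R G},
       [/\ U <> 0%VS /\ V <> 0%VS,
           (U <= cycle_space R o)%VS /\ (V <= cut_space R o)%VS,
           invariant_subspace (Cyc (R := R) o) U,
           invariant_subspace (Cyc (R := R) o) V
         & equivalent_restrictions (Cyc (R := R) o) U V]).
Proof.
have iso A : Cyc o A -> forall u v : edge_space R G, edot (A u) (A v) = edot u v.
  by case=> + _; apply: l1_isometry_edot.
have inv : invariant_subspace (Cyc (R := R) o) (cycle_space R o).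
  by move=> A [_ ->].
(* For this form [cut_space] is by definition the orthogonal complement of [cycle_space], so the
   general lemmas match the goal up to conversion. *)
pose form := @edot R T G : {symmetric edge_space R G}.
split.
  exact: (@unique_projection_no_equivalence _ _ form (@edot_aniso R T G) _ _ iso).
exact: (@no_equivalence_unique_projection _ _ form (@edot_aniso R T G) _ _ iso inv).
Qed.
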